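(* Given any $\gamma>0$ and an integer $r\ge 3$ there exists $n_0\in\mathbb N$ such that the following holds. Suppose that $G$ is a digraph on $n\ge n_0$ vertices where $r$ divides $n$ and that for every $x\in V(G)$, $d^+(x)\ge(1-1/r)n$ or $d^-(x)\ge (1-1/r)n$. Further suppose that for any $x,y\in V(G)$, if $d^+(x)<(1-1/r)n$ and $d^-(y)<(1-1/r)n$ then $xy\notin E(G)$. Then at least one of the following holds: (i) $G$ contains a perfect $T_r$-packing; (ii) $G$ contains a $\gamma$-independent set of size at least $n/r$.
   Context: A digraph has no loops and at most one edge in each direction between any two vertices; $xy$ denotes the edge from $x$ to $y$; $d^\pm(x)$ are out-/indegree. $T_r$ is the transitive tournament on $r$ vertices. A perfect $T_r$-packing is a collection of vertex-disjoint (not necessarily induced) copies of $T_r$ covering all vertices. For $G$ on $n$ vertices, $S\subseteq V(G)$ is $\gamma$-independent if $G[S]$ has at most $\gamma n^2$ edges. *)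

(* Defs.v *)
From mathcomp Require Import all_boot all_order all_algebra.
From mathcomp Require Import reals.

Set Implicit Arguments.
Unset Strict Implicit.
Unset Printing Implicit Defensive.

Import Order.TTheory GRing.Theory Num.Theory.

(* [edge x y] is the edge xy, directed from x to y; both [edge x y] and
   [edge y x] may hold. *)
Record digraph := Digraph {
  vertex :> finType;
  edge : rel vertex;
  edge_irr : irreflexive edge
}.

Section Digraph.
Variable G : digraph.

Definition outdeg (x : G) : nat := #|[set y : G | edge x y]|.
Definition indeg (x : G) : nat := #|[set y : G | edge y x]|.

Definition induced_edges (S : {set G}) : {set G * G} :=
  [set p : G * G | [&& p.1 \in S, p.2 \in S & edge p.1 p.2]].

Definition gamma_independent (R : realType) (gamma : R) (S : {set G}) : Prop :=
  (#|induced_edges S|%:R <= gamma * #|G|%:R ^+ 2)%R.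

End Digraph.

Definition transitive_tournament (r : nat) : digraph :=
  @Digraph 'I_r (fun i j => i < j) (fun i => ltnn i).

(* A (not necessarily induced) copy of H in G, given as an embedding of H. *)
Definition is_copy (H G : digraph) (f : {ffun H -> G}) : Prop :=
  injective f /\ forall u v : H, edge u v -> edge (f u) (f v).

Definition has_perfect_packing (H G : digraph) : Prop :=
  exists P : {set {ffun H -> G}},
    [/\ forall f, f \in P -> is_copy f,
        forall f g, f \in P -> g \in P -> f != g ->
          [disjoint codom f & codom g]
      & forall x : G, exists2 f, f \in P & x \in codom f].

(* Main.v *)
(* Reverse the edges at the vertices of small outdegree: let x point to y when
   yx is an edge, if x has small outdegree, and when xy is an edge otherwise.
   Every vertex then has outdegree at least (1 - 1/r)n, and a transitive
   tournament of the new digraph spans one of G, because each vertex, in the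
   new order, may be put before or after all its successors.  So (i) always
   holds, already with n0 = 0, by the theorem of Czygrinow, DeBiasio, Kierstead
   and Molla: a digraph on kr vertices of minimum outdegree at least k(r - 1)
   has a perfect T_r-packing.

   In the complement this says that a digraph on ks vertices of maximum
   outdegree less than k has a partition into k acyclic sets of size s.  The
   proof is the one of Kierstead and Kostochka for the Hajnal-Szemeredi theorem,
   with "x has no neighbour in W" replaced by "W + x is acyclic": if W + x is
   not acyclic, then x has both an outneighbour and an inneighbour in W, and
   either of the two can be used for counting.  Edges are added one vertex at a
   time; moving that vertex makes one class too large and another too small,
   and the defect is repaired by shifting vertices along a path of movable
   classes, or by recolouring the classes that cannot reach the small one by
   induction on the number of colours. *)
Require Import Defs.
From mathcomp Require Import all_boot all_order all_algebra.
From mathcomp Require Import reals zify ring.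

Set Implicit Arguments.
Unset Strict Implicit.
Unset Printing Implicit Defensive.

Import Order.TTheory GRing.Theory Num.Theory.

(** * Acyclic sets of vertices, and adding a vertex to them *)

Section Acyclic.
Variables (T : finType) (e : rel T).

(* On finite sets, absence of directed cycles (loops and 2-cycles included)
   amounts to every nonempty subset having a sink. *)
Definition acyclic (W : {set T}) : bool :=
  [forall X : {set T}, (X \subset W) && (X != set0) ==>
     [exists x in X, [forall y in X, ~~ e x y]]].

Lemma acyclicP (W : {set T}) :
  reflect (forall X : {set T}, X \subset W -> X != set0 ->
             exists2 x, x \in X & forall y, y \in X -> ~~ e x y)
          (acyclic W).
Proof.
apply: (iffP forallP) => [H X sXW nzX | H X].
  have := H X; rewrite sXW nzX /= => /exists_inP [x xX /forall_inP xP].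
  by exists x.
apply/implyP => /andP [sXW nzX]; have [x xX xP] := H X sXW nzX.
by apply/exists_inP; exists x => //; apply/forall_inP.
Qed.

Lemma acyclicS (W W' : {set T}) : W' \subset W -> acyclic W -> acyclic W'.
Proof.
move=> sW /acyclicP H; apply/acyclicP => X sX; apply: H.
exact: subset_trans sX sW.
Qed.

Hypothesis e_irr : irreflexive e.

Lemma acyclicU1_sink (W : {set T}) x :
  acyclic W -> (forall y, y \in W -> ~~ e x y) -> acyclic (x |: W).
Proof.
move=> /acyclicP H xP; apply/acyclicP => X sX nzX.
have [xX | xX] := boolP (x \in X).
  exists x => // y /(subsetP sX); rewrite !inE => /orP [/eqP -> | /xP //].
  by rewrite e_irr.
apply: H => //; apply/subsetP => y yX.
have := subsetP sX y yX; rewrite !inE => /orP [/eqP yx | //].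
by rewrite -yx yX in xX.
Qed.

(** A sink of the subset without [x] stays a sink, since it sends no edge to [x]. *)
Lemma acyclicU1_source (W : {set T}) x :
  acyclic W -> (forall y, y \in W -> ~~ e y x) -> acyclic (x |: W).
Proof.
move=> /acyclicP H xP; apply/acyclicP => X sX nzX.
have sXW : X :\ x \subset W by rewrite subDset.
have [X0 | nz] := eqVneq (X :\ x) set0.
  have Xx : X = [set x].
    by apply/eqP; move: X0 => /eqP; rewrite setD_eq0 subset1 (negPf nzX) orbF.
  by exists x; rewrite Xx ?set11 // => y /set1P ->; rewrite e_irr.
have [y yX yP] := H _ sXW nz.
exists y => [|w wX]; first by case/setD1P: yX.
have [-> | wx] := eqVneq w x; first exact: xP (subsetP sXW _ yX).
by apply: yP; rewrite !inE wx.
Qed.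

Definition outn x (X : {set T}) : nat := #|[set y in X | e x y]|.
Definition inn y (X : {set T}) : nat := #|[set x in X | e x y]|.

Lemma sum_outn_inn (X Y : {set T}) :
  \sum_(x in X) outn x Y = \sum_(y in Y) inn y X.
Proof.
have oE x : outn x Y = \sum_(y in Y) e x y.
  by rewrite /outn -sum1dep_card big_mkcondr.
have iE y : inn y X = \sum_(x in X) e x y.
  by rewrite /inn -sum1dep_card big_mkcondr.
rewrite (eq_bigr _ (fun x _ => oE x)) exchange_big /=.
by apply: eq_bigr => y _; rewrite iE.
Qed.

Lemma outn_gt0 (W : {set T}) x :
  acyclic W -> ~~ acyclic (x |: W) -> 0 < outn x W.
Proof.
move=> aW; apply: contraR; rewrite -eqn0Ngt cards_eq0 => /eqP out0.
apply: acyclicU1_sink => // y yW; apply/negP => exy.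
by have := in_set0 y; rewrite -out0 !inE yW exy.
Qed.

Lemma inn_gt0 (W : {set T}) x :
  acyclic W -> ~~ acyclic (x |: W) -> 0 < inn x W.
Proof.
move=> aW; apply: contraR; rewrite -eqn0Ngt cards_eq0 => /eqP out0.
apply: acyclicU1_source => // y yW; apply/negP => exy.
by have := in_set0 y; rewrite -out0 !inE yW exy.
Qed.

End Acyclic.

(** * Vertices that separate others from a root *)

Section Terminal.
Variables (C : finType) (h : rel C) (a : C).

(** Deleting [w] is encoded as isolating it; [connect] stays reflexive at [w], whence the guard
    [c != w] in [cut]. *)
Definition avoiding (w : C) : rel C :=
  [rel x y | [&& h x y, x != w & y != w]].

Let A := [set c | connect h c a].
Let cut (w : C) :=
  [set c in A | (c != w) && ~~ connect (avoiding w) c a].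

Lemma connect_avoiding_root c : c != a -> ~~ connect (avoiding a) c a.
Proof.
move=> ca; apply/negP => /connectP [p].
elim/last_ind: p => [_ /= ac | p d _]; first by rewrite ac eqxx in ca.
rewrite rcons_path last_rcons => /and3P [_ _ /andP [_ da]] ad.
by rewrite ad eqxx in da.
Qed.

(** A path to [a] that avoids [u] cannot meet [w]: its tail would join [w] to [a] without [u]. *)
Lemma cut_connect u w c : w \in cut u -> connect (avoiding u) c a ->
  c != w /\ connect (avoiding w) c a.
Proof.
rewrite !inE => /and3P [_ wu nwa] /connectP [p].
elim: p c => [c _ /= <- | d p IH c /= /andP [cd pd] lp].
  by split; [apply: contraNneq nwa => <- | ]; exact: connect0.
have [dw cda] := IH d pd lp.
have cw : c != w.
  apply: contraNneq nwa => <-; apply/connectP; exists (d :: p) => //=.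
  by rewrite pd andbT.
split=> //; apply: connect_trans cda; apply: connect1 => /=.
by case/and3P: cd => hcd _ _; apply/and3P.
Qed.

Lemma cut_subset u w : u \in A -> w \in cut u -> cut w \proper cut u.
Proof.
move=> uA wu; apply/properP; split; last first.
  by exists w => //; rewrite !inE eqxx andbF.
apply/subsetP => c; rewrite !inE => /and3P [cA cw nca].
have ncu : ~~ connect (avoiding u) c a.
  by apply: contra nca => /(cut_connect wu) [].
rewrite cA ncu andbT /=; apply: contraNneq nca => cu.
(* Here [c = u]: after its first step, a duplicate-free path from [u] to [a] avoids [u], hence also
   [w] by [cut_connect]. *)
move: uA; rewrite inE cu => /connectP [p0 pp0 lp0].
case/shortenP: pp0 lp0 => [[|d p']] pp uniqp _ lp.
  by rewrite /= in lp; rewrite lp; exact: connect0.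
move: pp uniqp => /= /andP [hud pd] /and3P [unp _ _].
have [dw dwa] : d != w /\ connect (avoiding w) d a.
  apply: cut_connect wu _; apply/connectP; exists p' => //.
  move: unp; rewrite inE negb_or => /andP [ud unp].
  elim: p' d pd ud unp {hud lp} => //= d' p IH d /andP [hdd' pd'] ud.
  rewrite inE negb_or => /andP [ud' unp].
  rewrite IH // andbT; apply/and3P; split; by rewrite // eq_sym.
apply: connect_trans dwa; apply: connect1 => /=.
by apply/and3P; split=> //; rewrite -cu.
Qed.

(* Take [L] to be a smallest nonempty set of vertices cut off from [a] by
   deleting a single vertex [u]. *)
Lemma exists_terminal : (exists2 c, c \in A & c != a) ->
  exists u (L : {set C}),
    [/\ L != set0, L \subset A, a \notin L,
        forall w c, w \in L -> c \in A -> c != w -> connect (avoiding w) c a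
      & forall w d, w \in L -> d \in A -> h w d -> d \in u |: L].
Proof.
case=> c cA ca.
have aP : (a \in A) && (cut a != set0).
  rewrite inE connect0 /=; apply/set0Pn; exists c.
  by rewrite inE cA ca connect_avoiding_root.
pose P u := (u \in A) && (cut u != set0).
case: (@arg_minnP _ a P (fun u => #|cut u|) aP) => u /andP [uA nz] umin.
exists u, (cut u); split=> //.
- by apply/subsetP => x; rewrite inE => /andP [].
- by rewrite !inE !connect0 andbF.
(* Otherwise [cut w] would be nonempty and, by [cut_subset], smaller than [cut u]. *)
- move=> w d wu dA dw; apply: contraT => nda.
  have wA : w \in A by move: wu; rewrite inE => /andP [].
  have := umin w; rewrite /P wA /= leqNgt proper_card ?cut_subset //.
  by apply; apply/set0Pn; exists d; rewrite inE dA dw.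
- move=> w d wu dA hwd; rewrite in_setU1.
  have [//|du /=] := eqVneq d u.
  rewrite inE dA du /=; apply/negP => dua.
  move: wu; rewrite inE => /and3P [_ wu /negP []].
  by apply: connect_trans dua; apply: connect1; apply/and3P.
Qed.

End Terminal.

(** * Equitable acyclic colourings, and shifting vertices between classes *)

Section Coloring.
Variables (T C : finType) (e : rel T).
Hypothesis e_irr : irreflexive e.
Implicit Types (V : {set T}) (K L : {set C}) (f g : T -> C).

Definition color_class V f c := [set x in V | f x == c].

Lemma card_color_classes V f L :
  #|[set x in V | f x \in L]| = \sum_(c in L) #|color_class V f c|.
Proof.
rewrite -sum1_card (partition_big f (mem L)) /=; last first.
  by move=> x; rewrite inE => /andP [].
apply: eq_bigr => c cL; rewrite -sum1_card; apply: eq_bigl => x; rewrite !inE.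
by case: eqP => [->|]; rewrite ?cL ?andbT ?andbF.
Qed.

Lemma outn_color_classes V f L x :
  outn e x [set y in V | f y \in L] =
  \sum_(c in L) outn e x (color_class V f c).
Proof.
have E (P : pred C) : [set y in [set y in V | P (f y)] | e x y] =
    [set y in [set y in V | e x y] | P (f y)].
  by apply/setP=> y; rewrite !inE andbAC.
rewrite /outn (E (mem L)) card_color_classes; apply: eq_bigr => c _.
by rewrite (E (pred1 c)).
Qed.

Lemma exists_free_color V K f x :
  {in V, forall y, f y \in K} -> outn e x V < #|K| ->
  exists2 c, c \in K & forall y, y \in color_class V f c -> ~~ e x y.
Proof.
move=> fK; have {1}-> : V = [set y in V | f y \in K].
  by apply/setP => y; rewrite inE; case: (boolP (y \in V)) => // /fK ->.
rewrite outn_color_classes => lt_out.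
have /exists_inP [c cK /eqP out0] :
    [exists c in K, outn e x (color_class V f c) == 0].
  apply: contraLR lt_out; rewrite negb_exists_in => /forall_inP outK.
  by rewrite -leqNgt -sum1_card leq_sum // => c /outK; rewrite lt0n.
exists c => // y yc; apply/negP => exy.
by have := in_set0 y; rewrite -(cards0_eq out0) in_set yc exy.
Qed.

Definition equitable V K s f :=
  [/\ {in V, forall x, f x \in K},
      {in K, forall c, acyclic e (color_class V f c)}
    & {in K, forall c, #|color_class V f c| = s}].

(* For [a != b] the class of [a] has size [s - 1] and that of [b] size [s + 1];
   for [a = b] this is [equitable]. *)
Definition nearly_equitable V K s f a b :=
  [/\ {in V, forall x, f x \in K},
      {in K, forall c, acyclic e (color_class V f c)},
      a \in K, b \in K
    & {in K, forall c, #|color_class V f c| + (c == a) = s + (c == b)}].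

Lemma nearly_equitable_refl V K s f a :
  nearly_equitable V K s f a a -> equitable V K s f.
Proof. by case=> fK ac _ _ sz; split=> // c /sz /addIn. Qed.

(** The auxiliary digraph of Kierstead and Kostochka on the colours, with acyclic sets in place of
    independent ones. *)
Definition movable V K f : rel C :=
  [rel c d | [&& c \in K, d \in K &
     [exists y in color_class V f c, acyclic e (y |: color_class V f d)]]].

Lemma movable_sub V K f f1 c d : movable V K f c d ->
  color_class V f c \subset color_class V f1 c ->
  color_class V f1 d \subset color_class V f d -> movable V K f1 c d.
Proof.
move=> /and3P [cK dK /exists_inP [y yc ay]] sc sd; apply/and3P; split=> //.
apply/exists_inP; exists y; first exact: (subsetP sc).
by apply: acyclicS ay; rewrite setUS.
Qed.

Definition recolor f y c : T -> C := fun x => if x == y then c else f x.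

Lemma color_class_recolor V f y c d : y \in V ->
  color_class V (recolor f y c) d =
  if d == c then y |: color_class V f d else color_class V f d :\ y.
Proof.
move=> yV; rewrite [d == c]eq_sym; apply/setP=> x.
case: (eqVneq c d) => cd; rewrite !inE /recolor;
  by case: (eqVneq x y) => //= ->; rewrite yV ?cd ?eqxx // (negPf cd).
Qed.

Lemma nearly_equitable_recolor V K s f a b c y :
  nearly_equitable V K s f a b -> y \in color_class V f b -> c \in K ->
  c != b -> acyclic e (y |: color_class V f c) ->
  nearly_equitable V K s (recolor f y c) a c.
Proof.
case=> fK ac aK bK sz yb cK cb acy.
have yV : y \in V by move: yb; rewrite inE => /andP [].
have fy : f y = b by move: yb; rewrite inE => /andP [_ /eqP].
split=> // [x xV | d dK | d dK].
- by rewrite /recolor; case: ifP => // _; exact: fK.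
- rewrite color_class_recolor //; case: (eqVneq d c) => [-> // | _].
  by apply: acyclicS (ac d dK); rewrite subsetDl.
- have := sz d dK; rewrite color_class_recolor //.
  case: (eqVneq d c) => [-> | dc].
    by rewrite cardsU1 inE fy [b == c]eq_sym (negPf cb) andbF /=; clear; lia.
  rewrite (cardsD1 y (color_class V f d)) inE yV fy [b == d]eq_sym.
  by case: (d == b) => /=; clear; lia.
Qed.

(** Moving the witness of the first edge passes the surplus on to the next class. On a
    duplicate-free path the later classes are unchanged and the new start has only gained a vertex,
    so the rest of the path survives; at [a] the surplus fills the gap. *)
Lemma shift_along_path V K s f a b : nearly_equitable V K s f a b ->
  connect (movable V K f) b a -> exists f', equitable V K s f'.
Proof.
move=> nf /connectP [p0 pp0 lp0].
case/shortenP: pp0 lp0 => p pp up _ lp {p0}.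
elim: p b f nf pp up lp => [|c p IH] b f nf /= pp up lp.
  by exists f; apply: (@nearly_equitable_refl _ _ _ _ a); rewrite {2}lp.
case/andP: pp => /and3P [_ cK /exists_inP [y yb acy]] pp.
case/and3P: up; rewrite inE negb_or => /andP [bc bp] cp up.
have cb : c != b by rewrite eq_sym.
have nf' := nearly_equitable_recolor nf yb cK cb acy.
have yV : y \in V by move: yb; rewrite inE => /andP [].
have fy : f y = b by move: yb; rewrite inE => /andP [_ /eqP].
apply: IH nf' _ _ lp; last by rewrite /= cp.
have E d : d != c -> d != b ->
    color_class V (recolor f y c) d = color_class V f d.
  move=> dc db; rewrite color_class_recolor // (negPf dc); apply/setDidPl.
  by rewrite disjoint_sym disjoints1 inE fy [b == d]eq_sym (negPf db) andbF.
have sub d : d != b -> color_class V f d \subset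
    color_class V (recolor f y c) d.
  move=> db; have [-> | dc] := eqVneq d c; last by rewrite E.
  by rewrite color_class_recolor // eqxx subsetU1.
have lift q d : d != b -> b \notin q -> c \notin q ->
    path (movable V K f) d q -> path (movable V K (recolor f y c)) d q.
  elim: q d => //= x q IHq d db; rewrite !inE !negb_or.
  move=> /andP [bx bq] /andP [cx cq] /andP [mv pq].
  have xb : x != b by rewrite eq_sym.
  rewrite (movable_sub mv) ?sub ?IHq // E // eq_sym //.
exact: lift.
Qed.

End Coloring.

(** * One round of the Kierstead-Kostochka argument, when the large class cannot reach the small
    one *)

Section KiersteadKostochka.
Variables (T C : finType) (e : rel T).
Hypothesis e_irr : irreflexive e.
Variables (V : {set T}) (K : {set C}) (s : nat).
Hypothesis outV : {in V, forall x, outn e x V < #|K|}.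

Variables (f : T -> C) (a b : C).
Hypothesis nf : nearly_equitable e V K s f a b.

Let h := movable e V K f.
Let A := [set c | connect h c a].
Let B := [set x in V | f x \in K :\: A].
Let cl := color_class V f.

Hypothesis hb : ~~ connect h b a.

Let fK : {in V, forall x, f x \in K}. Proof. by case: nf. Qed.
Let ac : {in K, forall c, acyclic e (cl c)}. Proof. by case: nf. Qed.
Let aK : a \in K. Proof. by case: nf. Qed.
Let bK : b \in K. Proof. by case: nf. Qed.
Let aA : a \in A. Proof. by rewrite inE connect0. Qed.
Let bA : b \notin A. Proof. by rewrite inE. Qed.

Let AK : A \subset K.
Proof.
apply/subsetP => c; rewrite inE => /connectP [[_ /= <- //|d p]].
by case/andP => /and3P [].
Qed.

Let sizeK c : c \in K -> #|cl c| + (c == a) = s + (c == b).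
Proof. by case: nf => _ _ _ _; apply. Qed.

Let sizeA c : c \in A -> #|cl c| + (c == a) = s.
Proof.
move=> cA; rewrite sizeK ?(subsetP AK) //.
case: eqP => [cb | _]; last by rewrite addn0.
by rewrite cb (negPf bA) in cA.
Qed.

Let memB x : (x \in B) = (x \in V) && (f x \notin A).
Proof.
rewrite !inE; case xV: (x \in V) => //=.
by rewrite fK // andbT.
Qed.

Let BV : B \subset V.
Proof. by apply/subsetP => x; rewrite memB => /andP []. Qed.

Let cardK : #|K| = #|A| + #|K :\: A|.
Proof. by rewrite -(cardsID A K); move/setIidPr: AK => ->. Qed.

Let A_gt0 : 0 < #|A|.
Proof. by rewrite card_gt0; apply/set0Pn; exists a. Qed.

Let q_lt : #|K :\: A| < #|K|.
Proof. by rewrite cardK; move: A_gt0; clear; lia. Qed.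

(** The large class [b] is inaccessible, while the small class [a] is accessible. *)
Let cardB : #|B| = #|K :\: A| * s + 1.
Proof.
have bKA : b \in K :\: A by rewrite inE bA bK.
rewrite card_color_classes (eq_bigr (fun c => s + (c == b))); last first.
  move=> c /setDP [cK cA]; have := sizeK cK; rewrite -/(cl c).
  by case: eqP => [ca | _]; [rewrite ca aA in cA | clear; lia].
rewrite big_split /= sum_nat_const; congr (_ + _).
by rewrite (bigD1 b) //= eqxx big1 ?addn0 // => c /andP [_ /negPf -> //].
Qed.

Let clV c : cl c \subset V.
Proof. by apply/subsetP => x; rewrite inE => /andP []. Qed.

(** If [y] could join [cl c], its own class would be accessible too. *)
Let stuck y c : y \in B -> c \in A -> ~~ acyclic e (y |: cl c).
Proof.
rewrite memB => /andP [yV nfy] cA; apply: contra nfy => acy.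
rewrite inE; move: (cA); rewrite inE; apply: connect_trans; apply: connect1.
apply/and3P; split; rewrite ?fK ?(subsetP AK) //.
by apply/exists_inP; exists y; rewrite ?inE ?yV ?eqxx.
Qed.

Let outn_split x :
  outn e x V = outn e x B + \sum_(c in A) outn e x (cl c).
Proof.
have -> : outn e x V = outn e x [set y in V | f y \in K].
  congr (outn e x _); apply/setP => y; rewrite inE.
  by case yV: (y \in V) => //=; rewrite fK.
rewrite outn_color_classes (big_setID A) /=; move/setIidPr: AK => ->.
by rewrite addnC -outn_color_classes.
Qed.

(** Every class in [L] uses up one of the at most [#|K| - 1] out-edges of [x]. *)
Let outB_bound x (L : {set C}) : x \in V -> L \subset A ->
  {in L, forall c, 0 < outn e x (cl c)} -> outn e x B + #|L| < #|K|.
Proof.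
move=> xV LA Lout; apply: leq_ltn_trans (outV xV); rewrite outn_split.
rewrite leq_add2l (big_setID L) /=; move/setIidPr: LA => ->.
by apply: leq_trans (leq_addr _ _); rewrite -sum1_card leq_sum.
Qed.

(** By [stuck], [y] has an out-neighbour in each accessible class. The bound allows [B] minus a
    vertex to be recoloured with the inaccessible colours. *)
Let outB_lt y : y \in B -> outn e y B < #|K :\: A|.
Proof.
move=> yB; have : outn e y B + #|A| < #|K|.
  apply: outB_bound; rewrite ?(subsetP BV) // => c cA.
  by apply: outn_gt0; rewrite ?ac ?(subsetP AK) // stuck.
by rewrite cardK addnC ltn_add2l.
Qed.

Let outn_sub x (X Y : {set T}) : X \subset Y -> outn e x X <= outn e x Y.
Proof.
move=> XY; apply/subset_leq_card/subsetP => y; rewrite !inE => /andP [yX ->].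
by rewrite (subsetP XY).
Qed.

(** The repair move: [y] leaves [B] and replaces [z], which goes to [X]; what is left of [B] has the
    right size for a fresh equitable colouring [g]. *)
Definition exchange z X y (g : T -> C) : T -> C :=
  fun x => if x == z then X else if x == y then f z
           else if x \in B then g x else f x.

(** * The classes after an exchange *)

Section Exchange.
Variables (z : T) (X : C) (y : T) (g : T -> C).
Hypotheses (zV : z \in V) (fzA : f z \in A) (yB : y \in B).
Hypotheses (XK : X \in K) (XW : X != f z) (fza : f z != a).
Hypothesis eg : equitable e (B :\ y) (K :\: A) s g.

Let rest c := if c \in A then cl c else color_class (B :\ y) g c.

Let yNz : y != z.
Proof. by apply: contraTneq yB => ->; rewrite memB fzA andbF. Qed.

Lemma color_class_exchange c :
  color_class V (exchange z X y g) c =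
  if c == f z then y |: (cl c :\ z)
  else if c == X then z |: rest c else rest c.
Proof.
have yV := subsetP BV y yB.
have gK x : x \in B :\ y -> g x \notin A.
  by case: eg => gK _ _ /gK; rewrite inE => /andP [].
apply/setP => x; rewrite inE /exchange.
have [-> | xz] := eqVneq x z.
  rewrite zV /=; have [cfz | cfz] := eqVneq c (f z).
    by rewrite !inE eqxx /= orbF cfz (negPf XW) eq_sym (negPf yNz).
  have [-> | cX] := eqVneq c X; first by rewrite setU11.
  rewrite /rest; case: ifP => cA.
    by rewrite inE eq_sym (negPf cfz) andbF.
  by rewrite inE in_setD1 memB fzA !andbF.
have [-> | xy] := eqVneq x y.
  rewrite yV /=; have [cfz | cfz] := eqVneq c (f z).
    by rewrite setU11.
  have E : (y \in rest c) = false.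
    rewrite /rest; case: ifP => cA; last by rewrite inE in_setD1 eqxx.
    rewrite inE; apply/negP => /andP [_ /eqP fy].
    by move: yB; rewrite memB fy cA andbF.
  by case: ifP => _; rewrite ?inE ?E ?(negPf yNz).
have E : (x \in V) && ((if x \in B then g x else f x) == c) = (x \in rest c).
  have [xB | xB] := boolP (x \in B); last first.
    rewrite /rest; case: ifP => cA; rewrite inE //.
    rewrite in_setD1 (negPf xB) andbF; apply/negP => /andP [xV /eqP fx].
    by rewrite memB xV fx cA in xB.
  have gx : g x \notin A by apply: gK; rewrite in_setD1 xy.
  rewrite (subsetP BV) //= /rest; case: ifP => cA; last first.
    by rewrite inE in_setD1 xy xB.
  rewrite (_ : (x \in cl c) = false).
    by apply: contraNF gx => /eqP ->.
  apply/negP; rewrite inE => /andP [_ /eqP fx].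
  by move: xB; rewrite memB fx cA andbF.
have [cfz | cfz] := eqVneq c (f z).
  by rewrite /= E /rest cfz fzA !in_setU1 !in_setD1 (negPf xy) xz.
by rewrite /= E; case: ifP => _; rewrite // in_setU1 (negPf xz).
Qed.

(** The surplus of [B] leaves with [y], and the class of [z] trades one vertex for another, so the
    surplus ends up in [X]. *)
Lemma nearly_equitable_exchange :
  acyclic e (y |: (cl (f z) :\ z)) -> acyclic e (z |: rest X) ->
  nearly_equitable e V K s (exchange z X y g) a X.
Proof.
move=> acW acX; have [gK gac gsz] := eg.
have acR c : c \in K -> acyclic e (rest c).
  move=> cK; rewrite /rest; case: ifP => cA; first exact: ac.
  by apply: gac; rewrite in_setD cA.
have szR c : c \in K -> #|rest c| + (c == a) = s.
  move=> cK; rewrite /rest; case: ifP => cA; first exact: sizeA.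
  rewrite gsz; last by rewrite in_setD cA.
  by have [ca|] := eqVneq c a; [rewrite ca aA in cA | rewrite addn0].
split=> // [x xV | c cK | c cK].
- rewrite /exchange; case: ifP => // _; case: ifP => [_|xy].
    exact: (subsetP AK).
  case: ifP => xB; last exact: fK.
  by have /setDP [] : g x \in K :\: A by apply: gK; rewrite in_setD1 xy.
- rewrite color_class_exchange; case: eqP => [-> // | _].
  by case: eqP => [-> // | _]; apply: acR.
- rewrite color_class_exchange; have [-> | cW] := eqVneq c (f z).
    have := sizeA fzA; rewrite [f z == X]eq_sym (negPf XW) (negPf fza) !addn0.
    rewrite (cardsD1 z) inE zV eqxx cardsU1 => <-; congr (_ + _).
    have -> // : y \notin cl (f z) :\ z.
    apply: contraL yB; rewrite in_setD1 inE => /and3P [_ _ /eqP fy].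
    by rewrite memB fy fzA andbF.
  have [cX | cX] := eqVneq c X; last by rewrite szR // addn0.
  have zR : z \notin rest c.
    rewrite /rest; case: ifP => cA.
      by rewrite inE eq_sym (negPf cW) andbF.
    by rewrite inE in_setD1 memB fzA !andbF.
  by rewrite cardsU1 zR -(szR c cK) add1n addSn addn1.
Qed.

Let rest_sub c : c != f z ->
  rest c \subset color_class V (exchange z X y g) c.
Proof.
move=> /negPf cW; rewrite color_class_exchange cW.
by case: ifP => _ //; apply: subsetU1.
Qed.

Lemma movable_exchange c d : c \in A -> d \in A -> c != f z -> d != f z ->
  d != X -> h c d -> movable e V K (exchange z X y g) c d.
Proof.
move=> cA dA cW dW dX hcd; apply: movable_sub hcd _ _.
  by apply: subset_trans (rest_sub cW); rewrite /rest cA.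
by rewrite color_class_exchange (negPf dW) (negPf dX) /rest dA.
Qed.

(** Accessible classes other than [f z] and [X] are unchanged. As [X] may only gain a vertex, it can
    start the path but not occur later on it. *)
Lemma connect_exchange c p : path (avoiding h (f z)) c p -> last c p = a ->
  X \notin p -> connect (movable e V K (exchange z X y g)) c a.
Proof.
elim: p c => [c _ /= -> _ | d p IH c /= /andP [cd pd] lp].
  exact: connect0.
rewrite inE negb_or eq_sym => /andP [dX Xp].
have {}IH := IH d pd lp Xp.
have dA : d \in A.
  rewrite inE; apply/connectP; exists p => //; apply: sub_path pd.
  by move=> ? ? /and3P [].
have cA : c \in A.
  move: dA; rewrite !inE; apply: connect_trans; apply: connect1.
  by case/and3P: cd.
case/and3P: cd => hcd cW dW; apply: connect_trans IH; apply: connect1.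
exact: movable_exchange.
Qed.

End Exchange.

Hypothesis smaller_equitable : forall (V' : {set T}) (K' : {set C}),
  #|K'| < #|K| -> #|V'| = #|K'| * s ->
  {in V', forall x, outn e x V' < #|K'|} ->
  exists g, equitable e V' K' s g.

Let split_B y : y \in B -> exists g, equitable e (B :\ y) (K :\: A) s g.
Proof.
move=> yB; apply: smaller_equitable => // [|x /setD1P [_ xB]].
  by have := cardsD1 y B; rewrite yB cardB addnC => /addnI.
by apply: leq_ltn_trans (outB_lt xB); rewrite outn_sub // subsetDl.
Qed.

(** Otherwise every vertex of [B] has an in-neighbour in [cl a], whose [s - 1] vertices send at most
    [#|K :\: A|] edges each to [B]: too few for [#|K :\: A| * s + 1] vertices. *)
Let another_accessible : exists2 c, c \in A & c != a.
Proof.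
apply/exists_inP; apply: contraT; rewrite negb_exists_in => /forall_inP allA.
have A1 : #|A| = 1.
  apply/eqP/cards1P; exists a; apply/setP => c; rewrite in_set1.
  apply/idP/eqP => [/allA | -> //]; by rewrite negbK => /eqP.
have : \sum_(y in B) 1 <= \sum_(y in B) inn e y (cl a).
  by apply: leq_sum => y yB; apply: inn_gt0; rewrite ?ac // stuck.
rewrite sum1_card -sum_outn_inn.
have le_sum : \sum_(x in cl a) outn e x B <= \sum_(x in cl a) #|K :\: A|.
  apply: leq_sum => x xa.
  have := @outB_bound x set0 (subsetP (clV a) x xa) (sub0set _).
  rewrite cards0 cardK A1 addn0 add1n ltnS; apply => c; by rewrite inE.
move=> /leq_trans /(_ le_sum); rewrite sum_nat_const cardB.
by have := sizeA aA; rewrite eqxx; clear; nia.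
Qed.

Lemma acyclic_swap_out y z : f z \in A ->
  [set x in cl (f z) | e y x] = [set z] -> acyclic e (y |: (cl (f z) :\ z)).
Proof.
move=> fzA yz; apply: acyclicU1_sink => //.
  by apply: acyclicS (ac (subsetP AK _ fzA)); rewrite subsetDl.
move=> x /setD1P [xz xc]; apply: contraNN xz => eyx.
by rewrite -in_set1 -yz inE xc.
Qed.

Lemma acyclic_swap_in y z : f z \in A ->
  [set x in cl (f z) | e x y] = [set z] -> acyclic e (y |: (cl (f z) :\ z)).
Proof.
move=> fzA yz; apply: acyclicU1_source => //.
  by apply: acyclicS (ac (subsetP AK _ fzA)); rewrite subsetDl.
move=> x /setD1P [xz xc]; apply: contraNN xz => exy.
by rewrite -in_set1 -yz inE xc.
Qed.

(** * Terminal classes: the others reach [a] without any one of them *)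

Section Terminals.
Variables (u : C) (L : {set C}).
Hypotheses (nzL : L != set0) (LA : L \subset A) (aL : a \notin L).
Hypothesis term :
  forall w c, w \in L -> c \in A -> c != w -> connect (avoiding h w) c a.
Hypothesis uL : forall w d, w \in L -> d \in A -> h w d -> d \in u |: L.

(** The exchange puts the surplus into [X], which still reaches [a] without using the terminal class
    [f z]; shifting along that path finishes. *)
Lemma equitable_of_swap z y X : z \in V -> f z \in L -> y \in B ->
  X \in A -> X != f z -> acyclic e (y |: (cl (f z) :\ z)) ->
  acyclic e (z |: cl X) -> exists f', equitable e V K s f'.
Proof.
move=> zV fzL yB XA XW acW acX.
have fzA := subsetP LA _ fzL.
have fza : f z != a by apply: contraNneq aL => <-.
have [g eg] := split_B yB.
have XK := subsetP AK X XA.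
have nf1 : nearly_equitable e V K s (exchange z X y g) a X.
  by apply: nearly_equitable_exchange => //; rewrite XA.
apply: (shift_along_path nf1).
case/connectP: (term fzL XA XW) => p0 pp0 lp0.
case/shortenP: pp0 lp0 => p pp /= /andP [Xp _] _ lp.
exact: connect_exchange pp (esym lp) Xp.
Qed.

Hypothesis noswap : forall z y X, z \in V -> f z \in L -> y \in B ->
  acyclic e (y |: (cl (f z) :\ z)) ->
  X \in A -> X != f z -> ~~ acyclic e (z |: cl X).

(** By [noswap], [z] has an out-neighbour in each of the [#|A| - 1] other accessible classes. *)
Lemma outB_swappable z y : z \in V -> f z \in L -> y \in B ->
  acyclic e (y |: (cl (f z) :\ z)) -> outn e z B <= #|K :\: A|.
Proof.
move=> zV fzL yB acW.
have : outn e z B + #|A :\ f z| < #|K|.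
  apply: outB_bound; rewrite ?subsetDl // => c /setD1P [cW cA].
  by apply: outn_gt0; rewrite ?ac ?(subsetP AK) // (noswap zV fzL yB).
by rewrite cardK (cardsD1 (f z) A) (subsetP LA _ fzL); clear; lia.
Qed.

(** By [uL], [x] cannot join an accessible class outside [u |: L], so it has an out-neighbour in
    each of them. *)
Lemma outB_terminal x : x \in V -> f x \in L ->
  outn e x B <= #|K :\: A| + #|L|.
Proof.
move=> xV fxL.
have le_card : #|A| <= #|A :\: (u |: L)| + #|L|.+1.
  rewrite -(cardsID (u |: L) A) addnC leq_add2l.
  apply: leq_trans (subset_leq_card (subsetIr _ _)) _.
  by rewrite cardsU1; case: (u \notin L).
have : outn e x B + #|A :\: (u |: L)| < #|K|.
  apply: outB_bound; rewrite ?subsetDl // => c /setDP [cA cuL].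
  apply: outn_gt0; rewrite ?ac ?(subsetP AK) //.
  apply: contraNN cuL => acx; apply: (uL fxL cA).
  apply/and3P; split; rewrite ?fK ?(subsetP AK) //.
  by apply/exists_inP; exists x; rewrite // inE xV /=.
by rewrite cardK; move: le_card; clear; lia.
Qed.

Let card_terminal c : c \in L -> #|cl c| = s.
Proof.
move=> cL; rewrite -(sizeA (subsetP LA _ cL)).
by case: eqP => [ca | _]; [case/negP: aL; rewrite -ca | rewrite addn0].
Qed.

(* Counts the edges from one terminal class to [B], those that start at the
   unique in-neighbour of some vertex of [B] twice. *)
Lemma inaccessible_lt_terminal : #|K :\: A| < #|L|.
Proof.
have /set0Pn [w wL] := nzL; have wA := subsetP LA _ wL.
pose S := [set z in cl w | [exists y in B, [set x in cl w | e x y] == [set z]]].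
have le2 : \sum_(y in B) 2 <= \sum_(y in B) (inn e y (cl w) + inn e y S).
  apply: leq_sum => y yB.
  have : 0 < inn e y (cl w) by apply: inn_gt0; rewrite ?ac ?(subsetP AK) ?stuck.
  rewrite leq_eqVlt => /orP [/eqP in1|in2]; last by apply: ltn_addr.
  rewrite -in1 ltnS card_gt0; have /eqP/cards1P [z zP] := esym in1.
  have /setIdP [zw ezy] : z \in [set x in cl w | e x y] by rewrite zP set11.
  apply/set0Pn; exists z; rewrite !inE ezy andbT -[f z == w]andTb.
  move: (zw); rewrite inE => -> /=.
  by apply/exists_inP; exists y => //; apply/eqP.
have Sw : S \subset cl w by apply/subsetP => z /setIdP [].
have leS : \sum_(x in S) outn e x B <= #|S| * #|K :\: A|.
  rewrite -sum_nat_const; apply: leq_sum => z /setIdP [zw].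
  move: (zw); rewrite inE => /andP [zV /eqP fz] /exists_inP [y yB /eqP yz].
  apply: (@outB_swappable z y); rewrite ?fz //.
  by rewrite -fz; apply: acyclic_swap_in; rewrite fz.
have leD : \sum_(x in cl w :\: S) outn e x B
    <= #|cl w :\: S| * (#|K :\: A| + #|L|).
  rewrite -sum_nat_const; apply: leq_sum => z /setDP [].
  rewrite inE => /andP [zV /eqP fz] _.
  by apply: outB_terminal; rewrite ?fz.
have cS : #|S| + #|cl w :\: S| = s.
  by rewrite -(card_terminal wL) -(cardsID S (cl w)); move/setIidPr: Sw => ->.
have sumw : \sum_(x in cl w) outn e x B =
    \sum_(x in S) outn e x B + \sum_(x in cl w :\: S) outn e x B.
  by rewrite (big_setID S) /=; move/setIidPr: Sw => ->.
(* With [q] for [#|K :\: A|], the count reads [2(qs + 1) <= 2|S|q + (s - |S|)(q + |L|)]; if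
   [|L| <= q], the right side is at most [2qs]. *)
move: le2; rewrite sum_nat_const big_split /= -2!sum_outn_inn sumw cardB.
rewrite ltnNge; move=> le2; apply/negP => leLq.
have leD2 : #|cl w :\: S| * (#|K :\: A| + #|L|)
    <= #|cl w :\: S| * (#|K :\: A| + #|K :\: A|).
  by rewrite leq_mul2l leq_add2l leLq orbT.
by move: le2 leS (leq_trans leD leD2); rewrite -cS !mulnDr; clear; lia.
Qed.

(** The solo edges of Kierstead and Kostochka: by [acyclic_swap_out], [y] can replace [z] when [f z]
    is accessible. *)
Let solo : rel T := [rel y z | [set x in cl (f z) | e y x] == [set z]].
Let LV := [set x in V | f x \in L].

(** Among its fewer than [#|K|] out-neighbours, [y] has at least one in each accessible class, and
    at least two in each class of [L] that contains no solo neighbour. *)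
Lemma many_solo y : y \in B ->
  #|L| + 1 + outn e y B <= #|K :\: A| + outn solo y LV.
Proof.
move=> yB; have yV := subsetP BV y yB.
pose N := [set c in L | outn e y (cl c) == 1].
have N_solo : #|N| <= outn solo y LV.
  apply: leq_trans (leq_imset_card f _); apply: subset_leq_card.
  apply/subsetP => c /setIdP [cL /cards1P [z zP]].
  have /setIdP [] : z \in [set x in cl c | e y x] by rewrite zP set11.
  rewrite inE => /andP [zV /eqP fz] _; apply/imsetP; exists z => //.
  by rewrite [_ \in _]inE inE zV /= fz cL /solo /= fz zP eqxx.
have N_sum : #|A| + #|L :\: N| <= \sum_(c in A) outn e y (cl c).
  rewrite -sum1_card (big_setID (L :\: N)) /=.
  rewrite [X in _ <= X](big_setID (L :\: N)) /= addnAC.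
  rewrite (setIidPr _); last by apply: subset_trans LA; apply: subsetDl.
  have gt0 c : c \in A -> 0 < outn e y (cl c).
    by move=> cA; apply: outn_gt0; rewrite ?ac ?(subsetP AK) // stuck.
  apply: leq_add; last by apply: leq_sum => c /setDP [/gt0].
  rewrite -sum1_card -big_split /=; apply: leq_sum => c /setDP [cL cN].
  have := gt0 c (subsetP LA _ cL); rewrite leq_eqVlt eq_sym => /orP [c1|//].
  by case/negP: cN; rewrite inE cL.
have LN : #|L| = #|N| + #|L :\: N|.
  rewrite -(cardsID N L); congr (_ + _); congr #|pred_of_set _|.
  by apply/setIidPr/subsetP => c /setIdP [].
have := outV yV; rewrite outn_split cardK LN; move: N_solo N_sum; clear; lia.
Qed.

(* [y1] and [y2] come from a maximal subset [I] of [B] without 2-cycles: it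
   dominates [B], so that [\sum_(y in I) (1 + outn e y B) >= #|B|]. *)
Lemma exists_two_solo : exists z y1 y2,
  [/\ z \in LV, y1 \in B, y2 \in B, y1 != y2 & solo y1 z && solo y2 z
      && ~~ (e y1 y2 && e y2 y1)].
Proof.
pose indep (I : {set T}) := (I \subset B) &&
  [forall x in I, forall y in I, ~~ (e x y && e y x)].
have indep0 : indep set0.
  by rewrite /indep sub0set; apply/forall_inP => x; rewrite inE.
have [I /maxsetP [/andP [IB /forall_inP Iind] Imax] _] := maxset_exists indep0.
have cover x : x \in B -> 0 < \sum_(y in I) ((x == y) + e y x).
  move=> xB; rewrite lt0n sum_nat_eq0 negb_forall_in.
  have [xI | xI] := boolP (x \in I).
    by apply/exists_inP; exists x; rewrite // eqxx.
  apply: contraNT xI; rewrite negb_exists_in => /forall_inP nox.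
  have nxy y : y \in I -> e y x = false.
    by move=> /nox; rewrite negbK addn_eq0 => /andP [_]; case: (e y x).
  rewrite -(Imax (x |: I)) ?setU11 ?subsetU1 // /indep subUset sub1set xB IB.
  apply/forall_inP => y /setU1P yI; apply/forall_inP => y' /setU1P y'I.
  case: yI y'I => [-> | yI] [-> | y'I]; rewrite ?e_irr ?nxy ?andbF //.
  by have /forall_inP := Iind y yI; apply.
have cardI : #|B| <= \sum_(y in I) (1 + outn e y B).
  rewrite -sum1_card; apply: (leq_trans (leq_sum _ cover)).
  rewrite exchange_big /=; apply: leq_sum => y yI; rewrite big_split /=.
  apply: leq_add; last by rewrite /outn -sum1dep_card big_mkcondr.
  rewrite (bigD1 y) ?(subsetP IB) //= eqxx big1 // => x /andP [_ /negPf -> //].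
have leI : \sum_(y in I) (1 + outn e y B) <= #|I| * #|K :\: A|.
  rewrite -sum_nat_const; apply: leq_sum => y yI.
  exact: outB_lt (subsetP IB _ yI).
have sum_solo : #|I| * #|L| + \sum_(y in I) (1 + outn e y B) <=
    #|I| * #|K :\: A| + \sum_(y in I) outn solo y LV.
  rewrite -!sum_nat_const -!big_split /=; apply: leq_sum => y yI.
  by rewrite addnA many_solo // (subsetP IB).
have cardLV : #|LV| = #|L| * s.
  rewrite card_color_classes -sum_nat_const.
  by apply: eq_bigr => c /card_terminal.
have qL := inaccessible_lt_terminal.
(* With [q] for [#|K :\: A|], there are at least [|I|(|L| - q) + |B|] solo edges from [I] to [LV].
   As [|I| > s] and [|B| = qs + 1], this exceeds [s|L|], so two of them share an end [z]. *)
have : #|LV| < \sum_(z in LV) inn solo z I.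
  rewrite -sum_outn_inn cardLV; rewrite cardB in cardI.
  have sI : s < #|I|.
    rewrite ltnNge; apply/negP => Is.
    have : #|I| * #|K :\: A| <= s * #|K :\: A| by rewrite leq_mul2r Is orbT.
    by move: cardI leI; clear; lia.
  have : s * (#|L| - #|K :\: A|) <= #|I| * (#|L| - #|K :\: A|).
    by rewrite leq_mul2r (ltnW sI) orbT.
  move: cardI sum_solo; rewrite -(subnKC (ltnW qL)) addKn !mulnDr !mulnDl.
  by clear; lia.
rewrite -sum1_card => lt_sum.
have /exists_inP [z zLV] : [exists z in LV, 1 < inn solo z I].
  apply: contraLR lt_sum; rewrite negb_exists_in => /forall_inP le1.
  rewrite -leqNgt; apply: leq_sum => z /le1; by rewrite -leqNgt.
case/card_gt1P => y1 [y2] [/setIdP [y1I s1] /setIdP [y2I s2] y12].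
exists z, y1, y2; rewrite s1 s2; split; rewrite ?(subsetP IB) //.
by have /forall_inP := Iind y1 y1I; apply.
Qed.

(** Exchange [z] with [y1], sending [z] to an inaccessible colour. All of [A] stays accessible, and
    the new class of [y2] becomes so, because [y2] can follow [y1] into the class that [z] left. *)
Lemma exists_better : exists f' X, nearly_equitable e V K s f' a X /\
  #|[set c in K | ~~ connect (movable e V K f') c a]| < #|K :\: A|.
Proof.
have [z [y1 [y2 [zLV y1B y2B y12 /andP [/andP [/eqP s1 /eqP s2] dig]]]]] :=
  exists_two_solo.
move: zLV; rewrite inE => /andP [zV fzL]; have fzA := subsetP LA _ fzL.
have fza : f z != a by apply: contraNneq aL => <-.
have zfz : z \in cl (f z) by rewrite inE zV eqxx.
have ac1 := acyclic_swap_out fzA s1.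
have stay := noswap zV fzL y1B ac1.
have [g eg] := split_B y1B; have [gK gac _] := eg.
(* If [z] has no out-neighbour in its own class, then [y1] and [z] form the
   only cycle that [y1] can close there, so [z -> y1]. *)
have outz : outn e z (B :\ y1) < #|K :\: A|.
  have [ezy | nezy] := boolP (e z y1).
    apply: leq_trans (outB_swappable zV fzL y1B ac1).
    rewrite /outn [X in _ < X](cardsD1 y1) inE y1B ezy add1n ltnS.
    by apply: subset_leq_card; apply/subsetP => x; rewrite !inE -andbA.
  apply: (@leq_ltn_trans (outn e z B)); first by rewrite outn_sub ?subsetDl.
  rewrite -(ltn_add2l #|A|) -cardK addnC; apply: outB_bound => // c cA.
  have [-> | cz] := eqVneq c (f z); last first.
    by apply: outn_gt0; rewrite ?ac ?(subsetP AK) // stay.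
  apply: contraT; rewrite -eqn0Ngt cards_eq0 => /eqP out0.
  case/negP: (stuck y1B fzA).
  rewrite -(setD1K zfz) setUCA; apply: acyclicU1_sink => // x.
  case/setU1P => [-> // | /setD1P [_ xc]]; apply/negP => ezx.
  by have := in_set0 x; rewrite -out0 inE xc ezx.
have [X XKA Xout] := exists_free_color gK outz.
have /setDP [XK XA] := XKA.
have XW : X != f z by apply: contraNneq XA => ->.
have classE := color_class_exchange zV fzA y1B XW eg.
set f1 := exchange z X y1 g in classE.
have nf1 : nearly_equitable e V K s f1 a X.
  apply: nearly_equitable_exchange => //; rewrite (negPf XA).
  by apply: acyclicU1_sink => //; exact: gac.
have acc c : c \in A -> c != f z -> connect (movable e V K f1) c a.
  move=> cA cW; case/connectP: (term fzL cA cW) => p pp lp.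
  apply: (connect_exchange zV fzA y1B XW eg pp (esym lp)).
  apply: contraNN XA => Xp; rewrite inE; move: pp lp.
  case/splitPr: Xp => p1 p2; rewrite cat_path last_cat /=.
  case/and3P => _ _ pp2 lp2; apply/connectP; exists p2 => //.
  by apply: sub_path pp2 => ? ? /and3P [].
(* The first move out of [f z] is made by a vertex other than [z], which no other accessible class
   admits; that vertex is still there. *)
have accW : connect (movable e V K f1) (f z) a.
  move: (fzA); rewrite inE => /connectP [p0 pp0 lp0].
  case/shortenP: pp0 lp0 => [[|d p]] /= pp up _ lp.
    by rewrite lp eqxx in fza.
  case/andP: pp => hd pd; case/andP: up; rewrite inE negb_or eq_sym.
  case/andP => dW _ _.
  have dA : d \in A by rewrite inE; apply/connectP; exists p.
  have dX : d != X by apply: contraNneq XA => <-.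
  apply: connect_trans (acc d dA dW); apply: connect1.
  case/and3P: hd => WK dK /exists_inP [w ww acw].
  have wz : w != z by apply: contraTneq acw => ->; exact: stay.
  apply/and3P; split=> //; apply/exists_inP; exists w.
    by rewrite classE eqxx !inE wz; move: ww; rewrite inE => ->; rewrite orbT.
  by rewrite classE (negPf dW) (negPf dX) dA.
have y2B1 : y2 \in B :\ y1 by rewrite in_setD1 eq_sym y12.
have /setDP [gK2 gA2] := gK y2 y2B1.
exists f1, X; split => //; apply: proper_card; apply/properP; split.
  apply/subsetP => c /setIdP [cK ncc]; rewrite in_setD cK andbT.
  apply: contraNN ncc => cA.
  by have [-> | cW] := eqVneq c (f z); [exact: accW | exact: acc].
exists (g y2); first by rewrite in_setD gA2.
rewrite inE gK2 /= negbK; apply: connect_trans accW; apply: connect1.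
apply/and3P; split=> //; first exact: (subsetP AK).
apply/exists_inP; exists y2.
  rewrite inE (subsetP BV) //= /f1 /exchange y2B [y2 == y1]eq_sym (negPf y12).
  by have [y2z | _] := eqVneq y2 z; [rewrite y2z memB fzA andbF in y2B | ].
have ac2 := acyclic_swap_out fzA s2.
have noout y : [set x in cl (f z) | e y x] = [set z] ->
    forall x, x \in cl (f z) :\ z -> ~~ e y x.
  move=> yz x /setD1P [xz xc]; apply: contraNN xz => eyx.
  by rewrite -in_set1 -yz inE xc.
(* Once [z] is gone, [y1] and [y2] can have out-neighbours here only in each other; as they form no
   2-cycle, one of them is a sink. *)
rewrite classE eqxx; have [e21 | ne21] := boolP (e y2 y1).
  rewrite setUCA; apply: acyclicU1_sink => // x /setU1P [-> | ].
    by move: dig; rewrite e21 andbT.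
  exact: noout.
by apply: acyclicU1_sink => // x /setU1P [-> // | ]; exact: noout.
Qed.

End Terminals.

Lemma equitable_or_better :
  (exists f', equitable e V K s f') \/
  exists f' X, nearly_equitable e V K s f' a X /\
    #|[set c in K | ~~ connect (movable e V K f') c a]| < #|K :\: A|.
Proof.
have [u [L [nzL LA aL term uL]]] := exists_terminal another_accessible.
have [sw | nosw] := boolP [exists z in V, exists y in B, exists X in A,
  [&& f z \in L, X != f z, acyclic e (y |: (cl (f z) :\ z))
    & acyclic e (z |: cl X)]].
  left; case/exists_inP: sw => z zV /exists_inP [y yB /exists_inP [X XA]].
  case/and4P => fzL XW acW acX.
  exact: (equitable_of_swap LA aL term zV fzL yB XA XW acW acX).
right; apply: (exists_better nzL LA aL term uL) => z y X zV fzL yB acW XA XW.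
apply: contraNN nosw => acX; apply/exists_inP; exists z => //.
apply/exists_inP; exists y => //; apply/exists_inP; exists X => //.
exact/and4P.
Qed.

End KiersteadKostochka.

(** * Existence of equitable acyclic colourings *)

Section Equitable.
Variables (T C : finType).
Implicit Types (e : rel T) (V X : {set T}) (K : {set C}) (f : T -> C).

Lemma acyclic_sub_rel e e' (W : {set T}) :
  {in W &, forall x y, e x y -> e' x y} -> acyclic e' W -> acyclic e W.
Proof.
move=> sub /acyclicP ac; apply/acyclicP => X XW nzX.
have [x xX xP] := ac X XW nzX; exists x => // y yX.
by apply: contraNN (xP y yX) => /sub -> //; exact: (subsetP XW).
Qed.

Lemma exists_equipartition (c0 : C) V K s : #|V| = #|K| * s ->
  exists f, {in V, forall x, f x \in K} /\
            {in K, forall c, #|color_class V f c| = s}.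
Proof.
elim: {K}#|K| {-2}K (erefl #|K|) V => [|n IH] K cardK V cardV.
  exists (fun=> c0); split=> [x | c]; last by rewrite (cards0_eq cardK) inE.
  by move: cardV; rewrite cardK mul0n => /cards0_eq ->; rewrite inE.
have /card_gt0P [c cK] : 0 < #|K| by rewrite cardK.
pose V1 := [set x in take s (enum V)].
have sV : s <= #|V| by rewrite cardV cardK mulSn leq_addr.
have V1V : V1 \subset V.
  by apply/subsetP => x; rewrite inE => /mem_take; rewrite mem_enum.
have cardV1 : #|V1| = s.
  rewrite cardsE; have /card_uniqP -> := take_uniq s (enum_uniq V).
  by rewrite size_takel // -cardE.
have cardK' : #|K :\ c| = n.
  by have := cardsD1 c K; rewrite cK cardK add1n => -[].
have [|f [fK fs]] := IH (K :\ c) cardK' (V :\: V1).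
  by rewrite cardsD (setIidPr V1V) cardV1 cardV cardK cardK' mulSn addKn.
exists (fun x => if x \in V1 then c else f x); split=> [x xV | d dK].
  case: ifP => xV1 //.
  by have /setD1P [] : f x \in K :\ c by apply: fK; rewrite inE xV1.
have [dc | dc] := eqVneq d c.
  rewrite dc -[RHS]cardV1; congr #|pred_of_set _|.
  apply/setP => x; rewrite [LHS]inE.
  have [xV1|xV1] := boolP (x \in V1); first by rewrite eqxx (subsetP V1V).
  apply/negP => /andP [xV /eqP fx].
  have : f x \in K :\ c by apply: fK; rewrite inE xV1.
  by rewrite fx setD11.
have dKc : d \in K :\ c by rewrite in_setD1 dc.
rewrite -(fs d dKc); congr #|pred_of_set _|; apply/setP => x.
rewrite [LHS]inE [RHS]inE in_setD; case: (x \in V1) => //=.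
by rewrite eq_sym (negPf dc) andbF.
Qed.

Definition restrict X e : rel T := [rel x y | [&& x \in X, y \in X & e x y]].

Theorem equitable_acyclic_coloring (c0 : C) e V K s : irreflexive e ->
  #|V| = #|K| * s -> {in V, forall x, outn e x V < #|K|} ->
  exists f, equitable e V K s f.
Proof.
have [n] := ubnP #|K|; elim: n K e V => // n IHn K e V ltKn e_irr cardV outV.
have smaller e' (e'_irr : irreflexive e') (V' : {set T}) (K' : {set C}) :
    #|K'| < #|K| -> #|V'| = #|K'| * s ->
    {in V', forall x, outn e' x V' < #|K'|} ->
    exists g, equitable e' V' K' s g.
  by move=> ltK'; apply: IHn => //; apply: leq_trans ltK' _.
have nearly e' f a b : irreflexive e' ->
    {in V, forall x, outn e' x V < #|K|} ->
    nearly_equitable e' V K s f a b -> exists f', equitable e' V K s f'.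
  move=> e'_irr outV'.
  (* Rounds repeat with [a] fixed and ever fewer inaccessible classes. *)
  pose inacc f := [set c in K | ~~ connect (movable e' V K f) c a].
  have [m] := ubnP #|inacc f|; elim: m f b => // m IHm f b ltm nf.
  have [ba | nba] := boolP (connect (movable e' V K f) b a).
    exact: shift_along_path nf ba.
  have [// | [f' [X [nf' ltf']]]] :=
    equitable_or_better e'_irr outV' nf nba (smaller e' e'_irr).
  apply: IHm nf'; apply: leq_trans ltf' _; rewrite -ltnS.
  apply: leq_trans ltm; rewrite ltnS; apply: subset_leq_card.
  by apply/subsetP => c; rewrite !inE andbC.
have [f eqf] : exists f, equitable (restrict V e) V K s f.
  suff: forall m (X : {set T}), #|X| = m -> X \subset V ->
      exists f, equitable (restrict X e) V K s f by apply; [reflexivity | ].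
  elim=> [|m IHm] X cardX XV.
    have [f [fK fs]] := exists_equipartition c0 cardV.
    exists f; split=> // c cK.
    apply/acyclicP => Y _ /set0Pn [x xY]; exists x => // y _.
    by apply/negP => /and3P []; rewrite (cards0_eq cardX) inE.
  have /card_gt0P [u uX] : 0 < #|X| by rewrite cardX.
  have uV := subsetP XV u uX.
  have [||f [fK ac sz]] := IHm (X :\ u).
  - by have := cardsD1 u X; rewrite uX cardX add1n => -[].
  - by apply: subset_trans XV; apply: subsetDl.
  have X_irr : irreflexive (restrict X e).
    by move=> x; rewrite /restrict /= e_irr !andbF.
  have outX : {in V, forall x, outn (restrict X e) x V < #|K|}.
    move=> x xV; apply: leq_ltn_trans (outV x xV); apply: subset_leq_card.
    by apply/subsetP => y; rewrite !in_set => /andP [-> /and3P []].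
  (* As the edges between [u] and the rest of [X] return, [u] moves to a class without
     out-neighbours of [u]; its old class [f u] is now the small one and [c] the large one, unless
     they agree. *)
  have [c cK cfree] := exists_free_color fK (outX u uV).
  have acu d : d \in K -> acyclic (restrict X e) (color_class V f d :\ u).
    move=> dK; apply: acyclic_sub_rel (acyclicS (subsetDl _ [set u]) (ac d dK)).
    move=> x y /setD1P [xu _] /setD1P [yu _] /and3P [xX yX exy].
    by rewrite /restrict /= !in_setD1 xu yu xX yX.
  apply: (nearly (restrict X e) (recolor f u c) (f u) c X_irr outX).
  split=> [x xV | d dK | | // | d dK]; last 1 first.
  - rewrite color_class_recolor // -(sz d dK).
    have [-> | dc] := eqVneq d c.
      by rewrite cardsU1 inE uV /= eq_sym; case: eqP; rewrite ?addn0 ?addn1.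
    rewrite addn0 [in RHS](cardsD1 u) inE uV /= [f u == d]eq_sym addnC.
    by [].
  - by rewrite /recolor; case: ifP => _ //; apply: fK.
  - rewrite color_class_recolor //; case: eqP => [-> | _]; last exact: acu.
    have -> : u |: color_class V f c = u |: (color_class V f c :\ u).
      by apply/setP => x; rewrite !in_setU1 in_setD1; case: eqP.
    apply: acyclicU1_sink => // [|y /setD1P [_]]; [exact: acu | exact: cfree].
  - exact: fK.
exists f; case: eqf => fK ac sz; split=> // c cK.
apply: acyclic_sub_rel (ac c cK) => x y; rewrite !inE.
by case/andP => xV _ /andP [yV _] exy; rewrite /restrict /= xV yV.
Qed.

End Equitable.

(** * From colourings of the complement to packings *)

Section Transfer.
Variables (G : digraph) (p : pred G).

(* [p] marks the vertices of large indegree; all other vertices have large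
   outdegree. *)
Definition turned (x y : G) : bool := if p x then edge y x else edge x y.
Definition nonturned : rel G := [rel x y | (x != y) && ~~ turned x y].

Lemma nonturned_irr : irreflexive nonturned.
Proof. by move=> x; rewrite /nonturned /= eqxx. Qed.

Lemma outn_nonturned x :
  outn nonturned x setT + #|[set y | turned x y]| < #|G|.
Proof.
have xx : x \notin [set y | turned x y].
  by rewrite inE /turned; case: ifP; rewrite edge_irr.
have := cardsC (x |: [set y | turned x y]); rewrite cardsU1 xx => <-.
rewrite add1n addSn ltnS addnC leq_add2l; apply: subset_leq_card.
by apply/subsetP => y; rewrite !inE negb_or eq_sym.
Qed.

(* A vertex turned towards all later ones can be put first or last. *)
Lemma acyclic_transitive (W : {set G}) : acyclic nonturned W ->
  exists l, [/\ uniq l, l =i W & pairwise (@edge G) l].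
Proof.
elim: {W}#|W| {-2}W (erefl #|W|) => [|n IH] W cardW acW.
  by exists [::]; split=> // x; rewrite (cards0_eq cardW) inE.
have nzW : W != set0 by rewrite -card_gt0 cardW.
have [x xW xP] := acyclicP _ _ acW W (subxx W) nzW.
have [||l [ul lW pl]] := IH (W :\ x).
- by have := cardsD1 x W; rewrite xW cardW add1n => -[].
- by apply: acyclicS acW; apply: subsetDl.
have xl : x \notin l by rewrite lW setD11.
have turned_l : {in l, forall y, turned x y}.
  move=> y; rewrite lW => /setD1P [yx yW]; have := xP y yW.
  by rewrite /nonturned /= eq_sym yx /= negbK.
have [px | px] := boolP (p x).
  exists (rcons l x); split; first by rewrite rcons_uniq xl.
    by move=> y; rewrite mem_rcons inE lW in_setD1; case: eqP => [-> | //].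
  rewrite pairwise_rcons pl andbT; apply/allP => y /turned_l.
  by rewrite /turned px.
exists (x :: l); split; first by rewrite /= xl.
  by move=> y; rewrite inE lW in_setD1; case: eqP => [-> | //].
rewrite /= pl andbT; apply/allP => y /turned_l.
by rewrite /turned (negPf px).
Qed.

Lemma acyclic_copy r (W : {set G}) : acyclic nonturned W -> #|W| = r ->
  exists f : {ffun transitive_tournament r -> G}, is_copy f /\ codom f =i W.
Proof.
move=> acW cardW; have [l [ul lW pl]] := acyclic_transitive acW.
have szl : size l == r by rewrite -cardW -(eq_card lW) (card_uniqP ul).
pose t := Tuple szl.
exists [ffun i : 'I_r => tnth t i]; split; last first.
  move=> x; rewrite -lW; apply/codomP/idP => [[i ->] | xl].
    by rewrite ffunE; apply: (mem_tnth i t).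
  have /tnthP [i ->] : x \in t by [].
  by exists i; rewrite ffunE.
split=> [i j | i j ij].
  rewrite !ffunE; have /tuple_uniqP inj : uniq t := ul; exact: inj.
pose x0 := tnth t i; rewrite !ffunE (tnth_nth x0 t i) (tnth_nth x0 t j).
by move/(pairwiseP x0): pl; apply; rewrite // inE (eqP szl).
Qed.

Lemma has_packing_of_coloring k r (f : G -> 'I_k) :
  equitable nonturned setT setT r f ->
  has_perfect_packing (transitive_tournament r) G.
Proof.
case=> _ ac sz.
have copy c : exists F : {ffun transitive_tournament r -> G},
    is_copy F /\ codom F =i color_class setT f c.
  by apply: acyclic_copy; rewrite ?ac ?sz.
have [F FP] := fin_all_exists copy.
have cF c x : (x \in codom (F c)) = (f x == c).
  by have [_ ->] := FP c; rewrite inE inE.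
exists [set F c | c : 'I_k]; split.
- by move=> g /imsetP [c _ ->]; case: (FP c).
- move=> g g' /imsetP [c _ ->] /imsetP [d _ ->] neF.
  apply/pred0P => x; rewrite /= !cF; apply/andP => -[/eqP fc /eqP fd].
  by rewrite -fc fd eqxx in neF.
- by move=> x; exists (F (f x)); rewrite ?cF // imset_f.
Qed.

Lemma has_packing_of_turned_degree k r : #|G| = k * r ->
  (forall x, k * r.-1 <= #|[set y | turned x y]|) ->
  has_perfect_packing (transitive_tournament r) G.
Proof.
(* The empty digraph is set apart because a default colour in ['I_k] requires [0 < k]. *)
move=> cardG deg; have [G0 | /card_gt0P [x0 _]] := posnP #|G|.
  exists set0; split=> [f | f g | x]; rewrite ?inE //.
  by have := card0_eq G0 x.
have kr : 0 < k * r by rewrite -cardG; apply/card_gt0P; exists x0.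
have [k_gt0 r_gt0] : 0 < k /\ 0 < r by apply/andP; rewrite -muln_gt0.
have [f] : exists f : G -> 'I_k, equitable nonturned setT setT r f.
  apply: (equitable_acyclic_coloring (Ordinal k_gt0) nonturned_irr).
    by rewrite !cardsT card_ord.
  (* Since [k * r = k + k * r.-1], the complement has outdegrees below [k]. *)
  move=> x _; rewrite cardsT card_ord -(ltn_add2r (k * r.-1)).
  rewrite -mulnS prednK // -cardG; apply: leq_ltn_trans (outn_nonturned x).
  by rewrite leq_add2l.
exact: has_packing_of_coloring.
Qed.

End Transfer.

(** * The degree condition over the reals *)

Local Open Scope ring_scope.

Theorem theorem5p7 (R : realType) (gamma : R) (r : nat)
    (hgamma : 0 < gamma) (hr : (3 <= r)%N) :
  exists n0 : nat, forall G : digraph,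
    (n0 <= #|G|)%N ->
    (r %| #|G|)%N ->
    (forall x : G,
       (1 - 1 / r%:R) * #|G|%:R <= (outdeg x)%:R :> R \/
       (1 - 1 / r%:R) * #|G|%:R <= (indeg x)%:R :> R) ->
    (forall x y : G,
       (outdeg x)%:R < (1 - 1 / r%:R) * #|G|%:R :> R ->
       (indeg y)%:R < (1 - 1 / r%:R) * #|G|%:R :> R ->
       ~~ edge x y) ->
    has_perfect_packing (transitive_tournament r) G \/
    (exists S : {set G},
       gamma_independent gamma S /\ #|G|%:R / r%:R <= #|S|%:R :> R).
Proof.
exists 0 => G _ /dvdnP [k cardG] deg _; left.
have r_gt0 : (0 < r)%N by apply: leq_trans hr.
have degE : (1 - 1 / r%:R) * #|G|%:R = (k * r.-1)%:R :> R.
  have r_neq0 : r%:R != 0 :> R by rewrite pnatr_eq0 -lt0n.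
  by rewrite cardG !natrM -subn1 natrB //; field.
(* Vertices of small outdegree are turned; [deg] gives them large indegree. *)
pose p (x : G) := (outdeg x < k * r.-1)%N.
apply: (@has_packing_of_turned_degree G p k r cardG) => x.
have := deg x; rewrite degE !ler_nat /turned /p.
by case: ltnP => // _ [].
Qed.
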